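(* There is an equivalence between the category $\mathsf{SplExt}$ of split extensions of magmas and the category $\mathsf{Act}$ of actions of magmas, given by the following pair of functors (which are quasi-inverse to each other): (a) the functor $\mathsf{SplExt}\to\mathsf{Act}$ carries a morphism $(f,u,p):(B,X,A,\alpha,\beta,\kappa,\lambda)\to(B',X',A',\alpha',\beta',\kappa',\lambda')$ of split extensions to the morphism $(f,u):(B,X,h)\to(B',X',h')$ of the associated actions, where $h(b,x)=\lambda(\beta(b)+\kappa(x))$ and $h'(b',x')=\lambda'(\beta'(b')+\kappa'(x'))$; (b) the functor $\mathsf{Act}\to\mathsf{SplExt}$ carries a morphism $(f,u):(B,X,h)\to(B',X',h')$ of actions to the morphism $(f,u,p)$ between the corresponding semidirect product diagrams $(B,X,X\rtimes B,\pi_2,\iota_2,\iota_1,\pi_1)$ and $(B',X',X'\rtimes B',\pi_2',\iota_2',\iota_1',\pi_1')$ seen as split extensions, where $p:X\rtimes B\to X'\rtimes B'$ is defined by $p(x,b)=(u(x),f(b))$.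
   Context: A (unitary) magma is a set $M$ with an element $0$ and a binary operation $+$ satisfying $0+x=x=x+0$ for all $x\in M$ (no other axiom). A magma homomorphism is a map preserving $0$ and $+$. Sums of maps are taken pointwise; $1$ denotes identity maps and $0$ also denotes constant zero maps. Split extension of magmas: a seven-tuple $E=(B,X,A,\alpha,\beta,\kappa,\lambda)$ where $B,X,A$ are magmas, $\alpha:A\to B$, $\beta:B\to A$, $\kappa:X\to A$ are magma homomorphisms, $\lambda:A\to X$ is a map with $\lambda(0)=0$ (not necessarily preserving addition), and, for all $x\in X$, $a\in A$, $b\in B$: $\lambda\kappa=1$, $\alpha\beta=1$; $\lambda\beta=0$, $\alpha\kappa=0$; $\kappa\lambda+\beta\alpha=1$; $\lambda(\kappa(x)+\beta(b))=x$; $\kappa(x)+(\beta(b)+a)=(\kappa(x)+\beta(b))+a$; $\kappa(x)+(a+\beta(b))=(\kappa(x)+a)+\beta(b)$; $a+(\kappa(x)+\beta(b))=(a+\kappa(x))+\beta(b)$. A morphism $(B,X,A,\alpha,\beta,\kappa,\lambda)\to(B',X',A',\alpha',\beta',\kappa',\lambda')$ of split extensions is a triple $(f,u,p)$ of magma homomorphisms $f:B\to B'$, $u:X\to X'$, $p:A\to A'$ with $p\kappa=\kappa'u$, $p\beta=\beta'f$, $\lambda'p=u\lambda$, $\alpha'p=f\alpha$. Composition is componentwise; the resulting category is $\mathsf{SplExt}$. An action of a magma $B$ on a magma $X$ is a map $h:B\times X\to X$, written $h(b,x)=bx$, with $0x=x$ and $b0=0$ for all $x\in X$, $b\in B$.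 A morphism of actions $(B,X,h)\to(B',X',h')$ is a pair $(f,u)$ of magma homomorphisms $f:B\to B'$, $u:X\to X'$ with $u(h(b,x))=h'(f(b),u(x))$ for all $b\in B$, $x\in X$. The resulting category is $\mathsf{Act}$. Given an action of $B$ on $X$, the semidirect product $X\rtimes B$ is the magma with underlying set $X\times B$, addition $(x,b)+(x',b')=(x+bx',b+b')$ and zero $(0,0)$; the semidirect product diagram consists of $\iota_1:X\to X\rtimes B$, $\iota_1(x)=(x,0)$; $\iota_2:B\to X\rtimes B$, $\iota_2(b)=(0,b)$; $\pi_1(x,b)=x$; $\pi_2(x,b)=b$. It is a split extension $(B,X,X\rtimes B,\pi_2,\iota_2,\iota_1,\pi_1)$. *)

(* Defs.v *)
From HB Require Import structures.
From mathcomp Require Import all_boot ssralg boolp.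

Set Implicit Arguments.
Unset Strict Implicit.
Unset Printing Implicit Defensive.

Import GRing.Theory.
Local Open Scope ring_scope.
#[local] Obligation Tactic := idtac.

Record category := Category {
  obj :> Type;
  hom : obj -> obj -> Type;
  idm : forall x, hom x x;
  comp : forall x y z, hom y z -> hom x y -> hom x z;
  comp_idl : forall x y (f : hom x y), comp (idm y) f = f;
  comp_idr : forall x y (f : hom x y), comp f (idm x) = f;
  compA : forall w x y z (f : hom y z) (g : hom x y) (k : hom w x),
    comp f (comp g k) = comp (comp f g) k }.

Arguments hom {c} x y.
Arguments idm {c} x.
Arguments comp {c x y z} f g.

(* A functor is presented over its object map F0, so that two functors can be
   compared, or the value of a functor on a morphism described, without
   transporting along equalities of objects. *)
Record functor (C D : category) (F0 : C -> D) := Functor {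
  fmap : forall x y : C, hom x y -> hom (F0 x) (F0 y);
  fmap_id : forall x, fmap (idm x) = idm (F0 x);
  fmap_comp : forall x y z (f : hom y z) (g : hom x y),
    fmap (comp f g) = comp (fmap f) (fmap g) }.

Arguments fmap {C D F0} F {x y} f : rename.

Definition idF (C : category) : functor (fun x : C => x) :=
  @Functor C C _ (fun _ _ f => f) (fun _ => erefl) (fun _ _ _ _ _ => erefl).

Lemma compF_id (C D E : category) (F0 : C -> D) (G0 : D -> E)
    (G : functor G0) (F : functor F0) (x : C) :
  fmap G (fmap F (idm x)) = idm (G0 (F0 x)).
Proof. by rewrite !fmap_id. Qed.

Lemma compF_comp (C D E : category) (F0 : C -> D) (G0 : D -> E)
    (G : functor G0) (F : functor F0) (x y z : C)
    (f : hom y z) (g : hom x y) :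
  fmap G (fmap F (comp f g)) = comp (fmap G (fmap F f)) (fmap G (fmap F g)).
Proof. by rewrite !fmap_comp. Qed.

Definition compF (C D E : category) (F0 : C -> D) (G0 : D -> E)
    (G : functor G0) (F : functor F0) : functor (fun x => G0 (F0 x)) :=
  @Functor C E _ (fun _ _ f => fmap G (fmap F f))
    (compF_id G F) (compF_comp G F).

Definition is_iso (C : category) (x y : C) (f : hom x y) : Prop :=
  exists g : hom y x, comp g f = idm x /\ comp f g = idm y.

Definition nat_isomorphic (C D : category) (F0 G0 : C -> D)
    (F : functor F0) (G : functor G0) : Prop :=
  exists eta : forall x, hom (F0 x) (G0 x),
    (forall x y (f : hom x y), comp (eta y) (fmap F f) = comp (fmap G f) (eta x))
    /\ (forall x, is_iso (eta x)).

Definition quasi_inverse (C D : category) (F0 : C -> D) (G0 : D -> C)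
    (F : functor F0) (G : functor G0) : Prop :=
  nat_isomorphic (compF G F) (idF C) /\ nat_isomorphic (compF F G) (idF D).

(* The library's addUMagmaType is commutative and requires a choiceType, so the
   two unit laws are added to baseAddUMagmaType, which has no axioms.  Homomorphisms are the library's {additive U -> V}, which
   for baseAddUMagmaType are the maps preserving 0 and +. *)

HB.mixin Record BaseAddUMagma_isUnitary V of Algebra.BaseAddUMagma V := {
  add0m : left_id (0 : V) +%R;
  addm0 : right_id (0 : V) +%R
}.

#[short(type="unitaryMagmaType")]
HB.structure Definition UnitaryMagma :=
  {V of BaseAddUMagma_isUnitary V & Algebra.BaseAddUMagma V}.

Lemma additive_eq (U V : unitaryMagmaType) (f g : {additive U -> V}) :
  f =1 g -> f = g.
Proof.
move=> /funext; case: f g => f [[fP]] [g [[gP]]] /= fg.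
by rewrite -{}fg in gP *; rewrite (Prop_irrelevance fP gP).
Qed.

Record split_ext := SplitExt {
  seB : unitaryMagmaType;
  seX : unitaryMagmaType;
  seA : unitaryMagmaType;
  alpha : {additive seA -> seB};
  beta : {additive seB -> seA};
  kappa : {additive seX -> seA};
  lambda : seA -> seX;
  lambda0 : lambda 0 = 0;
  lambda_kappa : forall x, lambda (kappa x) = x;
  alpha_beta : forall b, alpha (beta b) = b;
  lambda_beta : forall b, lambda (beta b) = 0;
  alpha_kappa : forall x, alpha (kappa x) = 0;
  kappa_lambdaD : forall a, kappa (lambda a) + beta (alpha a) = a;
  lambdaD : forall x b, lambda (kappa x + beta b) = x;
  addKBA : forall x b a,
    kappa x + (beta b + a) = (kappa x + beta b) + a;
  addKAB : forall x a b,
    kappa x + (a + beta b) = (kappa x + a) + beta b;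
  addAKB : forall a x b,
    a + (kappa x + beta b) = (a + kappa x) + beta b }.

Arguments alpha {s}.
Arguments beta {s}.
Arguments kappa {s}.
Arguments lambda {s} a : rename.

Record split_ext_hom (E E' : split_ext) := SplitExtHom {
  seh_f : {additive seB E -> seB E'};
  seh_u : {additive seX E -> seX E'};
  seh_p : {additive seA E -> seA E'};
  seh_kappa : forall x, seh_p (kappa x) = kappa (seh_u x);
  seh_beta : forall b, seh_p (beta b) = beta (seh_f b);
  seh_lambda : forall a, lambda (seh_p a) = seh_u (lambda a);
  seh_alpha : forall a, alpha (seh_p a) = seh_f (alpha a) }.

Lemma split_ext_hom_eq (E E' : split_ext) (m n : split_ext_hom E E') :
  seh_f m =1 seh_f n -> seh_u m =1 seh_u n -> seh_p m =1 seh_p n -> m = n.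
Proof.
case: m n => f u p k b l a [f' u' p' k' b' l' a'] /=.
move=> /additive_eq ff' /additive_eq uu' /additive_eq pp'.
case: f' / ff' b' a' => b' a'; case: u' / uu' k' l' => k' l'.
case: p' / pp' k' b' l' a' => k' b' l' a'.
by congr SplitExtHom; apply: Prop_irrelevance.
Qed.

Definition split_ext_id (E : split_ext) : split_ext_hom E E :=
  @SplitExtHom E E idfun idfun idfun
    (fun _ => erefl) (fun _ => erefl) (fun _ => erefl) (fun _ => erefl).

Program Definition split_ext_comp (E E' E'' : split_ext)
    (m : split_ext_hom E' E'') (n : split_ext_hom E E') : split_ext_hom E E'' :=
  @SplitExtHom E E'' (seh_f m \o seh_f n) (seh_u m \o seh_u n)
    (seh_p m \o seh_p n) _ _ _ _.
Next Obligation. by move=> ? ? ? m n x /=; rewrite !seh_kappa. Qed.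
Next Obligation. by move=> ? ? ? m n b /=; rewrite !seh_beta. Qed.
Next Obligation. by move=> ? ? ? m n a /=; rewrite !seh_lambda. Qed.
Next Obligation. by move=> ? ? ? m n a /=; rewrite !seh_alpha. Qed.

Program Definition SplExt : category :=
  @Category split_ext split_ext_hom split_ext_id split_ext_comp _ _ _.
Next Obligation. by move=> *; apply: split_ext_hom_eq. Qed.
Next Obligation. by move=> *; apply: split_ext_hom_eq. Qed.
Next Obligation. by move=> *; apply: split_ext_hom_eq. Qed.

Record action (B X : unitaryMagmaType) := Action {
  act :> B -> X -> X;
  act0m : forall x, act 0 x = x;
  actm0 : forall b, act b 0 = 0 }.

Record magma_action := MagmaAction {
  maB : unitaryMagmaType;
  maX : unitaryMagmaType;
  mah : action maB maX }.

Record action_hom (H H' : magma_action) := ActionHom {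
  ah_f : {additive maB H -> maB H'};
  ah_u : {additive maX H -> maX H'};
  ah_act : forall b x, ah_u (mah H b x) = mah H' (ah_f b) (ah_u x) }.

Lemma action_hom_eq (H H' : magma_action) (m n : action_hom H H') :
  ah_f m =1 ah_f n -> ah_u m =1 ah_u n -> m = n.
Proof.
case: m n => f u h [f' u' h'] /= /additive_eq ff' /additive_eq uu'.
case: f' / ff' h' => h'; case: u' / uu' h' => h'.
by congr ActionHom; apply: Prop_irrelevance.
Qed.

Definition action_id (H : magma_action) : action_hom H H :=
  @ActionHom H H idfun idfun (fun _ _ => erefl).

Program Definition action_comp (H H' H'' : magma_action)
    (m : action_hom H' H'') (n : action_hom H H') : action_hom H H'' :=
  @ActionHom H H'' (ah_f m \o ah_f n) (ah_u m \o ah_u n) _.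
Next Obligation. by move=> ? ? ? m n b x /=; rewrite !ah_act. Qed.

Program Definition Act : category :=
  @Category magma_action action_hom action_id action_comp _ _ _.
Next Obligation. by move=> *; apply: action_hom_eq. Qed.
Next Obligation. by move=> *; apply: action_hom_eq. Qed.
Next Obligation. by move=> *; apply: action_hom_eq. Qed.

Program Definition ext_action (E : split_ext) : action (seB E) (seX E) :=
  @Action _ _ (fun b x => lambda (beta b + kappa x)) _ _.
Next Obligation. by move=> E x /=; rewrite raddf0 add0m lambda_kappa. Qed.
Next Obligation. by move=> E b /=; rewrite raddf0 addm0 lambda_beta. Qed.

Definition assoc_action (E : SplExt) : Act :=
  @MagmaAction (seB E) (seX E) (ext_action E).

(* An alias of X * B is needed because pairs already carry the library's
   componentwise addition. *)

Definition semidirect (B X : unitaryMagmaType) (h : action B X) : Type :=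
  (X * B)%type.

Definition semidirect_add (B X : unitaryMagmaType) (h : action B X)
    (s t : semidirect h) : semidirect h :=
  (s.1 + h s.2 t.1, s.2 + t.2).

HB.instance Definition _ (B X : unitaryMagmaType) (h : action B X) :=
  Algebra.hasAdd.Build (semidirect h) (@semidirect_add B X h).

HB.instance Definition _ (B X : unitaryMagmaType) (h : action B X) :=
  Algebra.hasZero.Build (semidirect h) (0, 0).

Lemma semidirect_add0m (B X : unitaryMagmaType) (h : action B X) :
  left_id (0 : semidirect h) +%R.
Proof. by case=> x b; congr pair; rewrite /= ?act0m add0m. Qed.

Lemma semidirect_addm0 (B X : unitaryMagmaType) (h : action B X) :
  right_id (0 : semidirect h) +%R.
Proof. by case=> x b; congr pair; rewrite /= ?actm0 addm0. Qed.

HB.instance Definition _ (B X : unitaryMagmaType) (h : action B X) :=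
  BaseAddUMagma_isUnitary.Build (semidirect h)
    (@semidirect_add0m B X h) (@semidirect_addm0 B X h).

Definition sd_in1 (B X : unitaryMagmaType) (h : action B X) (x : X) :
  semidirect h := (x, 0).

Definition sd_in2 (B X : unitaryMagmaType) (h : action B X) (b : B) :
  semidirect h := (0, b).

Definition sd_pr1 (B X : unitaryMagmaType) (h : action B X)
  (s : semidirect h) : X := s.1.

Definition sd_pr2 (B X : unitaryMagmaType) (h : action B X)
  (s : semidirect h) : B := s.2.

Lemma sd_in1_morph (B X : unitaryMagmaType) (h : action B X) :
  nmod_morphism (@sd_in1 B X h).
Proof. by split=> // x y; congr pair; rewrite /= ?act0m ?add0m. Qed.

Lemma sd_in2_morph (B X : unitaryMagmaType) (h : action B X) :
  nmod_morphism (@sd_in2 B X h).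
Proof. by split=> // x y; congr pair; rewrite /= ?actm0 ?add0m. Qed.

Lemma sd_pr2_morph (B X : unitaryMagmaType) (h : action B X) :
  nmod_morphism (@sd_pr2 B X h).
Proof. by []. Qed.

HB.instance Definition _ (B X : unitaryMagmaType) (h : action B X) :=
  Algebra.isNmodMorphism.Build X (semidirect h) (@sd_in1 B X h)
    (sd_in1_morph h).

HB.instance Definition _ (B X : unitaryMagmaType) (h : action B X) :=
  Algebra.isNmodMorphism.Build B (semidirect h) (@sd_in2 B X h)
    (sd_in2_morph h).

HB.instance Definition _ (B X : unitaryMagmaType) (h : action B X) :=
  Algebra.isNmodMorphism.Build (semidirect h) B (@sd_pr2 B X h)
    (sd_pr2_morph h).

Program Definition semidirect_ext (H : Act) : SplExt :=
  @SplitExt (maB H) (maX H) (semidirect (mah H))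
    (@sd_pr2 _ _ (mah H)) (@sd_in2 _ _ (mah H)) (@sd_in1 _ _ (mah H))
    (@sd_pr1 _ _ (mah H)) _ _ _ _ _ _ _ _ _ _.
Next Obligation. by []. Qed.
Next Obligation. by []. Qed.
Next Obligation. by []. Qed.
Next Obligation. by []. Qed.
Next Obligation. by []. Qed.
Next Obligation.
by move=> H [x b]; congr pair; rewrite /= ?act0m ?addm0 ?add0m.
Qed.
Next Obligation. by move=> H x b; rewrite /sd_pr1 /= act0m addm0. Qed.
Next Obligation.
by move=> H x b [y c]; congr pair; rewrite /= ?act0m ?addm0 ?add0m.
Qed.
Next Obligation.
by move=> H x [y c] b; congr pair; rewrite /= ?act0m ?actm0 ?addm0 ?add0m.
Qed.
Next Obligation.
by move=> H [y c] x b; congr pair; rewrite /= ?act0m ?actm0 ?addm0 ?add0m.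
Qed.

(* Main.v *)
Require Import Defs.
From HB Require Import structures.
From mathcomp Require Import all_boot ssralg.

(** A split extension is determined up to isomorphism by its action.  The
    identity [kappa (lambda a) + beta (alpha a) = a] and its converse
    [lambda (kappa x + beta b) = x] say that [(x, b) |-> kappa x + beta b] is a
    bijection from [X * B] onto [A], with inverse [a |-> (lambda a, alpha a)].
    Applying the first one to [a = beta b + kappa x] gives the commutation rule
      [beta b + kappa x = kappa (b x) + beta b]   (lemma [beta_kappaD]),
    where [b x = lambda (beta b + kappa x)] is the action of the extension.
    The three restricted associativity laws are just enough to rearrange
    [(kappa x + beta b) + (kappa x' + beta b')] so that this rule applies in the
    middle, which yields [kappa (x + b x') + beta (b + b')].  The bijection is
    therefore an isomorphism from the semidirect product onto [A]
    (lemma [from_semidirect_morph]); it is natural because morphisms of split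
    extensions commute with [kappa] and [beta].

    In the other direction, the action of the semidirect product extension is
    [(b, x) |-> pi1 ((0, b) + (x, 0)) = 0 + b x], that is, the action it was
    built from, so the identity maps give the second natural isomorphism. *)

Set Implicit Arguments.
Unset Strict Implicit.
Unset Printing Implicit Defensive.

Import GRing.Theory.
Local Open Scope ring_scope.

Lemma assoc_hom_act (E E' : split_ext) (m : split_ext_hom E E') b x :
  seh_u m (ext_action E b x) = ext_action E' (seh_f m b) (seh_u m x).
Proof. by rewrite /= -seh_lambda raddfD /= seh_beta seh_kappa. Qed.

Definition assoc_hom (E E' : SplExt) (m : hom E E') :
    hom (assoc_action E) (assoc_action E') :=
  @ActionHom (assoc_action E) (assoc_action E') _ _ (assoc_hom_act m).

Lemma assoc_hom_id (E : SplExt) : assoc_hom (idm E) = idm (assoc_action E).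
Proof. exact: action_hom_eq. Qed.

Lemma assoc_hom_comp (E E' E'' : SplExt) (m : hom E' E'') (n : hom E E') :
  assoc_hom (Defs.comp m n) = Defs.comp (assoc_hom m) (assoc_hom n).
Proof. exact: action_hom_eq. Qed.

Definition assoc_functor : functor assoc_action :=
  Functor assoc_hom_id assoc_hom_comp.

Definition semidirect_map (H H' : magma_action) (m : action_hom H H')
    (s : semidirect (mah H)) : semidirect (mah H') :=
  (ah_u m s.1, ah_f m s.2).

Lemma semidirect_map_morph (H H' : magma_action) (m : action_hom H H') :
  nmod_morphism (semidirect_map m).
Proof.
split; first by congr pair; rewrite raddf0.
by move=> s t; congr pair; rewrite raddfD ?ah_act.
Qed.

HB.instance Definition _ (H H' : magma_action) (m : action_hom H H') :=
  Algebra.isNmodMorphism.Build (semidirect (mah H)) (semidirect (mah H'))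
    (semidirect_map m) (semidirect_map_morph m).

Lemma semidirect_map_in1 (H H' : magma_action) (m : action_hom H H') x :
  semidirect_map m (sd_in1 (mah H) x) = sd_in1 (mah H') (ah_u m x).
Proof. by congr pair; rewrite raddf0. Qed.

Lemma semidirect_map_in2 (H H' : magma_action) (m : action_hom H H') b :
  semidirect_map m (sd_in2 (mah H) b) = sd_in2 (mah H') (ah_f m b).
Proof. by congr pair; rewrite raddf0. Qed.

Definition semidirect_hom (H H' : Act) (m : hom H H') :
    hom (semidirect_ext H) (semidirect_ext H') :=
  @SplitExtHom (semidirect_ext H) (semidirect_ext H')
    (ah_f m) (ah_u m) (semidirect_map m)
    (semidirect_map_in1 m) (semidirect_map_in2 m)
    (fun _ => erefl) (fun _ => erefl).

Lemma semidirect_hom_id (H : Act) :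
  semidirect_hom (idm H) = idm (semidirect_ext H).
Proof. by apply: split_ext_hom_eq => // -[]. Qed.

Lemma semidirect_hom_comp (H H' H'' : Act) (m : hom H' H'') (n : hom H H') :
  semidirect_hom (Defs.comp m n) = Defs.comp (semidirect_hom m) (semidirect_hom n).
Proof. exact: split_ext_hom_eq. Qed.

Definition semidirect_functor : functor semidirect_ext :=
  Functor semidirect_hom_id semidirect_hom_comp.

(** This is the decomposition [a = kappa (lambda a) + beta (alpha a)] of
    [a = beta b + kappa x], whose image under [alpha] is [b + 0]. *)
Lemma beta_kappaD (E : split_ext) (b : seB E) (x : seX E) :
  beta b + kappa x = kappa (ext_action E b x) + beta b.
Proof.
by rewrite -[LHS]kappa_lambdaD raddfD /= alpha_beta alpha_kappa addm0.
Qed.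

Section SplitExtIsSemidirect.

Variable E : SplExt.

Let S : unitaryMagmaType := semidirect (ext_action E).

Definition from_semidirect (s : S) : seA E := kappa s.1 + beta s.2.

Definition to_semidirect (a : seA E) : S := (lambda a, alpha a).

Lemma alphaD_kappa_beta (x : seX E) (b : seB E) :
  alpha (kappa x + beta b) = b.
Proof. by rewrite raddfD /= alpha_kappa alpha_beta add0m. Qed.

Lemma from_semidirectK : cancel from_semidirect to_semidirect.
Proof.
case=> x b.
by rewrite /from_semidirect /to_semidirect /= lambdaD alphaD_kappa_beta.
Qed.

Lemma to_semidirectK : cancel to_semidirect from_semidirect.
Proof. exact: kappa_lambdaD. Qed.

Lemma from_semidirect_morph : nmod_morphism from_semidirect.
Proof.
split; first by rewrite /from_semidirect !raddf0 add0m.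
case=> x b [x' b']; rewrite /from_semidirect /=.
(* The swap needs [beta b + kappa x'] isolated between [kappa x] and
   [beta b'].  It leaves [(kappa x + (kappa (b x') + beta b)) + beta b'], whose
   two [beta] terms come together only after the two [kappa] terms do, since
   [addKBA] expects a single [kappa] on the left. *)
rewrite [RHS]addAKB -(addKBA x b) [in RHS]beta_kappaD.
by rewrite addKAB -[kappa x + _]raddfD -addKBA -raddfD.
Qed.

(** In general [lambda] is not additive: this lemma amounts to
    [lambda (a + a') = lambda a + alpha a * lambda a'], with [*] the action.
    That identity is obtained by transport along the bijection. *)
Lemma to_semidirect_morph : nmod_morphism to_semidirect.
Proof.
have [from0 fromD] := from_semidirect_morph.
split=> [|a a']; apply: (can_inj from_semidirectK).
  by rewrite to_semidirectK from0.
by rewrite fromD !to_semidirectK.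
Qed.

HB.instance Definition _ :=
  Algebra.isNmodMorphism.Build S (seA E) from_semidirect from_semidirect_morph.

HB.instance Definition _ :=
  Algebra.isNmodMorphism.Build (seA E) S to_semidirect to_semidirect_morph.

Lemma from_semidirect_in1 (x : seX E) :
  from_semidirect (sd_in1 (ext_action E) x) = kappa x.
Proof. by rewrite /from_semidirect /= raddf0 addm0. Qed.

Lemma from_semidirect_in2 (b : seB E) :
  from_semidirect (sd_in2 (ext_action E) b) = beta b.
Proof. by rewrite /from_semidirect /= raddf0 add0m. Qed.

Lemma to_semidirect_kappa (x : seX E) :
  to_semidirect (kappa x) = sd_in1 (ext_action E) x.
Proof. by rewrite -from_semidirect_in1 from_semidirectK. Qed.

Lemma to_semidirect_beta (b : seB E) :
  to_semidirect (beta b) = sd_in2 (ext_action E) b.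
Proof. by rewrite -from_semidirect_in2 from_semidirectK. Qed.

Definition from_semidirect_hom :
    hom (semidirect_ext (assoc_action E)) E :=
  @SplitExtHom (semidirect_ext (assoc_action E)) E idfun idfun from_semidirect
    from_semidirect_in1 from_semidirect_in2
    (fun s => lambdaD s.1 s.2) (fun s => alphaD_kappa_beta s.1 s.2).

Definition to_semidirect_hom :
    hom E (semidirect_ext (assoc_action E)) :=
  @SplitExtHom E (semidirect_ext (assoc_action E)) idfun idfun to_semidirect
    to_semidirect_kappa to_semidirect_beta (fun _ => erefl) (fun _ => erefl).

Lemma from_semidirect_iso : is_iso from_semidirect_hom.
Proof.
exists to_semidirect_hom; split; apply: split_ext_hom_eq => //.
  exact: from_semidirectK.
exact: to_semidirectK.
Qed.

End SplitExtIsSemidirect.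

Lemma from_semidirect_natural (E E' : SplExt) (m : hom E E') :
  Defs.comp (from_semidirect_hom E')
      (fmap semidirect_functor (fmap assoc_functor m))
    = Defs.comp m (from_semidirect_hom E).
Proof.
apply: split_ext_hom_eq => // s /=.
by rewrite /from_semidirect raddfD /= seh_kappa seh_beta.
Qed.

Lemma ext_action_semidirect (H : Act) b x :
  ext_action (semidirect_ext H) b x = mah H b x.
Proof. exact: add0m. Qed.

Definition from_assoc_hom (H : Act) :
    hom (assoc_action (semidirect_ext H)) H :=
  @ActionHom (assoc_action (semidirect_ext H)) H idfun idfun
    (@ext_action_semidirect H).

Definition to_assoc_hom (H : Act) :
    hom H (assoc_action (semidirect_ext H)) :=
  @ActionHom H (assoc_action (semidirect_ext H)) idfun idfun
    (fun b x => esym (ext_action_semidirect b x)).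

Lemma from_assoc_iso (H : Act) : is_iso (from_assoc_hom H).
Proof. by exists (to_assoc_hom H); split; apply: action_hom_eq. Qed.

Lemma assoc_semidirect_quasi_inverse :
  quasi_inverse assoc_functor semidirect_functor.
Proof.
split.
  exists from_semidirect_hom; split; last exact: from_semidirect_iso.
  exact: from_semidirect_natural.
exists from_assoc_hom; split; last exact: from_assoc_iso.
by move=> H H' m; apply: action_hom_eq.
Qed.

Theorem theorem2p8 :
  exists (F : functor assoc_action) (G : functor semidirect_ext),
    [/\ forall (E E' : SplExt) (m : hom E E'),
          ah_f (fmap F m) = seh_f m /\ ah_u (fmap F m) = seh_u m,
        forall (H H' : Act) (m : hom H H'),
          [/\ seh_f (fmap G m) = ah_f m,
              seh_u (fmap G m) = ah_u m &
              forall (x : maX H) (b : maB H),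
                seh_p (fmap G m) (x, b) = (ah_u m x, ah_f m b)]
      & quasi_inverse F G].
Proof.
exists assoc_functor, semidirect_functor.
by split=> //; apply: assoc_semidirect_quasi_inverse.
Qed.
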